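(* Let $a$ be a positive integer, let $k=2^a-1$, let $V$ be a set of size $2k$, and let $D\subseteq\binom{V}{k}$ be a design with the parameters $(k-1)$-$(2k,k,2^{a-1})$. Then $D$ is anti-complementary, meaning that for all $K\in\binom{V}{k}$, we have $K\in D\iff V\setminus K\notin D$.
   Context: $\binom{V}{k}$ is the set of all $k$-element subsets of $V$. For a set $V$ of size $v$, a set $D\subseteq\binom{V}{k}$ is called a $t$-$(v,k,\lambda)$ design if for every $t$-element subset $T$ of $V$ there are exactly $\lambda$ elements of $D$ containing $T$. *)

(* Defs.v *)
From mathcomp Require Import all_boot.

Set Implicit Arguments.
Unset Strict Implicit.
Unset Printing Implicit Defensive.

Definition ksubsets (V : finType) (k : nat) : {set {set V}} :=
  [set K : {set V} | #|K| == k].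

(* The ground set V of the design is the whole finite type. Since D is a set,
   repeated blocks do not occur. *)
Definition is_design (V : finType) (t v k lambda : nat)
    (D : {set {set V}}) : Prop :=
  [/\ #|V| = v,
      D \subset ksubsets V k
    & forall T : {set V}, T \in ksubsets V t ->
        #|[set K in D | T \subset K]| = lambda].

Definition anti_complementary (V : finType) (k : nat)
    (D : {set {set V}}) : Prop :=
  forall K : {set V}, K \in ksubsets V k -> (K \in D <-> ~: K \notin D).

(* Main.v *)
(** Put [f B = 1] for blocks [B] and [f B = -1] for the other [k]-sets. As
    [2 ^ (a - 1)] is half the number [k + 1 = 2 ^ a] of [k]-sets containing a
    given [(k - 1)]-set, [f] sums to zero over the [k]-sets containing any
    [(k - 1)]-set.
    Fix a [k]-set [K] and let [S i] be the sum of [f] over the [k]-sets meeting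
    [K] in [i] points. Summing over all [(k - 1)]-sets meeting [K] in [i] points
    gives [(k - i) * S i + (i + 1) * S (i + 1) = 0], hence
    [S k = (-1) ^ k * S 0], i.e. [f K = - f (~: K)], since [k] is odd. *)

Require Import Defs.
From mathcomp Require Import all_boot.
From mathcomp Require Import all_algebra zify.

Import GRing.Theory Num.Theory.

Section Sets.
Variable V : finType.
Implicit Types A B K T : {set V}.

Lemma card_supersets_succ n T : #|T| = n ->
  #|[set B : {set V} | (#|B| == n.+1) && (T \subset B)]| = #|V| - n.
Proof.
move=> cT.
have -> : [set B : {set V} | (#|B| == n.+1) && (T \subset B)] =
          [set x |: T | x in ~: T].
  apply/setP=> B; rewrite inE; apply/andP/imsetP => [[/eqP cB TB]|[x xT ->]].
    have /cards1P[x Dx] : #|B :\: T| == 1 by rewrite cardsDS // cB cT subSnn.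
    exists x; first by rewrite inE; have := set11 x; rewrite -Dx inE => /andP[].
    by rewrite -Dx setUC -{1}(setIidPr TB) setID.
  by rewrite cardsU1 -in_setC xT cT add1n eqxx subsetUr.
rewrite card_in_imset => [|x y xT _ Exy]; first by rewrite cardsCs setCK cT.
have := setU11 x T; rewrite Exy in_setU1 => /orP[/eqP //|].
by move: xT; rewrite inE => /negbTE->.
Qed.

(** Each such [T] is [B :\ x] for a unique [x] in [B], and removing [x] lowers the intersection with
    [K] by one exactly when [x] lies in [K]. So [x] ranges over [B :\: K] in the first case and over
    [B :&: K] in the second. *)
Lemma card_subsets_pred_meet n i K B : #|B| = n.+1 ->
  #|[set T : {set V} | [&& #|T| == n, #|T :&: K| == i & T \subset B]]| =
    (#|B :&: K| == i) * (n.+1 - i) + (#|B :&: K| == i.+1) * i.+1.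
Proof.
move=> cB.
pose X := [set x in B | #|(B :\ x) :&: K| == i].
have -> : [set T : {set V} | [&& #|T| == n, #|T :&: K| == i & T \subset B]] =
          [set B :\ x | x in X].
  apply/setP=> T; rewrite inE; apply/and3P/imsetP => [[/eqP cT Ti TB]|[x]].
    have /cards1P[x Dx] : #|B :\: T| == 1 by rewrite cardsDS // cB cT subSnn.
    have xB : x \in B by have := set11 x; rewrite -Dx inE => /andP[].
    have DT : T = B :\ x by rewrite -Dx setDDr setDv set0U (setIidPr TB).
    by exists x; rewrite // inE xB -DT.
  rewrite inE => /andP[xB Bx] ->; split; rewrite ?subsetDl //.
  by move: cB; rewrite (cardsD1 x) xB => /eq_add_S->.
rewrite card_in_imset => [|x y]; last first.
  rewrite !inE => /andP[xB _] /andP[yB _] Exy.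
  by have := setD11 y B; rewrite -Exy !inE yB andbT eq_sym => /negbFE/eqP.
have cBK x : x \in B -> #|B :&: K| = (x \in K) + #|(B :\ x) :&: K|.
  by move=> xB; rewrite (cardsD1 x) inE xB setIDAC.
have [c|ni] := eqVneq #|B :&: K| i.
  rewrite c eqn_leq ltnn andbF mul0n mul1n addn0.
  suff -> : X = B :\: K by rewrite cardsD cB c.
  apply/setP=> x; rewrite !inE; have [xB|_] := boolP (x \in B); last by rewrite andbF.
  rewrite andbT; have := cBK x xB; rewrite c.
  by case: (x \in K); lia.
have [c|ni1] := eqVneq #|B :&: K| i.+1.
  rewrite mul0n mul1n.
  suff -> : X = B :&: K by rewrite c.
  apply/setP=> x; rewrite !inE; have [xB|//] := boolP (x \in B).
  have := cBK x xB; rewrite c.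
  by case: (x \in K); lia.
rewrite !mul0n; apply/eqP; rewrite cards_eq0; apply/eqP/setP=> x.
rewrite !inE; have [xB|//] := boolP (x \in B).
by have := cBK x xB; move: ni ni1; case: (x \in K); lia.
Qed.

Local Open Scope ring_scope.

Definition meet_sum n (f : {set V} -> int) K i : int :=
  \sum_(B : {set V} | (#|B| == n)%N && (#|B :&: K| == i)%N) f B.

(** Blocks have size [n.+1], so that the size [k - 1] is [n] without truncated subtraction. *)
Definition null_design n (f : {set V} -> int) : Prop :=
  forall T, #|T| = n -> \sum_(B : {set V} | (#|B| == n.+1)%N && (T \subset B)) f B = 0.

Lemma meet_sum_rec n f K i : null_design n f ->
  (n.+1 - i)%:R * meet_sum n.+1 f K i + i.+1%:R * meet_sum n.+1 f K i.+1 = 0.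
Proof.
move=> f0.
have : \sum_(T : {set V} | (#|T| == n)%N && (#|T :&: K| == i)%N)
         \sum_(B : {set V} | (#|B| == n.+1)%N && (T \subset B)) f B = 0.
  by apply: big1 => T /andP[/eqP cT _]; apply: f0.
(* Double counting: after the exchange, [f B] is weighted by the number of admissible [T] inside
   [B]. *)
rewrite (exchange_big_dep (fun B : {set V} => (#|B| == n.+1)%N)) /=; last first.
  by move=> T B _ /andP[].
move=> <-; rewrite /meet_sum !big_distrr /= 2!big_mkcondr -big_split /=.
apply: eq_bigr => B cB.
rewrite sumr_const.
have -> : #|[pred T : {set V} | (#|T| == n)%N && (#|T :&: K| == i)%N
                                & (#|B| == n.+1)%N && (T \subset B)]| =
          #|[set T : {set V} | [&& #|T| == n, #|T :&: K| == i & T \subset B]]|%N.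
  by apply: eq_card => T; rewrite !inE cB -andbA.
rewrite (card_subsets_pred_meet _ _ _ _ (eqP cB)) -[RHS]mulr_natl natrD mulrDl.
by do 2!case: eqP => _; rewrite ?mul1n ?mul0n ?mul0r.
Qed.

Lemma meet_sumE n f K i : null_design n f -> (i <= n.+1)%N ->
  meet_sum n.+1 f K i = (-1) ^+ i * 'C(n.+1, i)%:R * meet_sum n.+1 f K 0.
Proof.
move=> f0; elim: i => [|i IHi] lein; first by rewrite bin0 !mul1r.
have i1 : i.+1%:R != 0 :> int by rewrite pnatr_eq0.
apply: (mulfI i1); have /eqP := meet_sum_rec n f K i f0.
rewrite addrC addr_eq0 => /eqP->; rewrite IHi 1?ltnW //.
have /(congr1 (fun m : nat => m%:R : int)) := mul_bin_left n.+1 i.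
rewrite !natrM => E; rewrite exprS mulN1r !mulNr mulrN; congr (- _).
by rewrite [LHS]mulrA mulrCA -E [RHS]mulrA mulrCA.
Qed.

(** At [i = n.+1] the sum reduces to the term [K]; at [i = 0] it reduces to [~: K], which has
    exactly [n.+1] points. *)
Lemma null_design_setC n f K : null_design n f ->
  #|V| = (2 * n.+1)%N -> #|K| = n.+1 -> f K = (-1) ^+ n.+1 * f (~: K).
Proof.
move=> f0 cV cK; have := meet_sumE n f K n.+1 f0 (leqnn _).
rewrite binn mulr1 /meet_sum (big_pred1 K) => [->|B]; last first.
  apply/andP/eqP=> [[/eqP cB /eqP cBK]|->]; last by rewrite setIid cK.
  have BIK : B :&: K = B by apply/eqP; rewrite eqEcard subsetIl cB cBK leqnn.
  by apply/eqP; rewrite eqEcard cK cB leqnn andbT; apply/setIidPl.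
have cKC : #|~: K| = n.+1 by have := cardsC K; lia.
congr (_ * _); apply: big_pred1 => B.
rewrite cards_eq0 setI_eq0 disjoints_subset.
apply/andP/eqP=> [[/eqP cB BK]|->]; last by rewrite cKC eqxx subxx.
by apply/eqP; rewrite eqEcard BK cKC cB leqnn.
Qed.

End Sets.

Theorem corollary3 (a k : nat) (V : finType) (D : {set {set V}})
    (ha : 0 < a) (hk : k = 2 ^ a - 1) (hV : #|V| = 2 * k)
    (hDk : D \subset ksubsets V k)
    (hD : is_design (k - 1) (2 * k) k (2 ^ (a - 1)) D) :
  anti_complementary k D.
Proof.
move=> K; rewrite inE => /eqP cK.
have Ea : 2 ^ a = 2 * 2 ^ (a - 1) by rewrite -expnS subn1 prednK.
have a0 : 0 < 2 ^ (a - 1) by rewrite expn_gt0.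
(* Since [0 < a], [k] is at least 1. *)
case: k => [|n] in hk hV hDk hD cK *; first by lia.
case: hD => _ _; rewrite subn1 /= => hD.
have odd_n : odd n.+1 by lia.
pose f (B : {set V}) : int := ((B \in D)%:R *+ 2 - 1)%R.
have f0 : null_design V n f.
  (* The sum is twice the number of blocks containing [T] minus the number [2 * k - (k - 1) = 2 ^ a]
     of all [k]-sets containing [T]. *)
  move=> T cT; rewrite sumrB sumrMnl -natr_sum sumr_const -big_mkcondr sum1_card.
  have -> : #|[pred B : {set V} | (#|B| == n.+1) && (T \subset B) & B \in D]| =
            2 ^ (a - 1).
    rewrite -(hD T) ?inE ?cT //; apply: eq_card => B; rewrite !inE.
    have [/(subsetP hDk)|_] := boolP (B \in D); last by rewrite andbF.
    by rewrite inE => ->; rewrite andbT.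
  have -> : #|[pred B : {set V} | (#|B| == n.+1) && (T \subset B)]| = #|V| - n.
    by rewrite -(card_supersets_succ V n T cT); apply: eq_card => B; rewrite !inE.
  by rewrite -mulrnA; apply/eqP; rewrite subr_eq0; apply/eqP; congr (_%:R)%R; lia.
have := null_design_setC V n f K f0 hV cK.
(* The sign is -1, so exactly one of [K] and [~: K] is a block. *)
rewrite -signr_odd odd_n /f.
by case: (K \in D); case: (~: K \in D).
Qed.
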